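(* Let $\Omega\subset\mathbb{R}^2$ be a domain, $f\in L^\infty(\Omega)$, let $u_0$ be the trace of a fixed function in $H^1(\Omega;\mathbb{R}^2)$, let $g:\Omega\to\mathbb{R}$ be a fixed function, and let $$\mathcal{A}_g:=\{u\in H^1_{u_0}(\Omega;\mathbb{R}^2):\ \det\nabla u=g\ \text{a.e.}\}.$$ Then for all $u,v\in\mathcal{A}_g$, $$\mathbb{D}(v)=\mathbb{D}(u)+a(u,v-u)+F(v-u),$$ where $\mathbb{D}(u)=\int_\Omega|\nabla u|^2\,dx$, $F(u)=\int_\Omega|\nabla u|^2+f\det\nabla u\,dx$, and $$a(u,\varphi):=\int_\Omega 2\nabla u\cdot\nabla\varphi+f\,\mathrm{cof}\,\nabla u\cdot\nabla\varphi\,dx .$$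
   Context: $H^1_{u_0}(\Omega;\mathbb{R}^2)$ is the set of $v\in H^1(\Omega;\mathbb{R}^2)$ with $v=u_0$ on $\partial\Omega$ in the sense of traces. For matrices $A\cdot B=\mathrm{tr}(A^TB)$, $|A|^2=A\cdot A$; for $A\in\mathbb{R}^{2\times2}$ with rows $(a,b)$, $(c,d)$, $\mathrm{cof}\,A$ has rows $(d,-c)$, $(-b,a)$. *)

(* Defs.v *)
From HB Require Import structures.
From mathcomp Require Import all_boot all_order all_algebra.
From mathcomp Require Import all_classical all_reals all_analysis.
Set Implicit Arguments.
Unset Strict Implicit.
Unset Printing Implicit Defensive.
Import Order.TTheory GRing.Theory Num.Theory.
Import numFieldNormedType.Exports.
Local Open Scope classical_set_scope.
Local Open Scope ring_scope.

(* Points of the plane are pairs; vector fields are total functions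
   R * R -> 'rV[R]_2 of which only the values on Omega matter.  Elements of
   Lebesgue and Sobolev spaces are represented by Borel functions. *)

Definition leb2 (R : realType) :=
  (@lebesgue_measure R \x @lebesgue_measure R)%E.

Definition domain (R : realType) (Omega : set (R * R)) : Prop :=
  [/\ open Omega, connected Omega & Omega !=set0].

Definition basis2 (R : realType) (j : 'I_2) : R * R :=
  if j == ord0 then (1, 0) else (0, 1).

Definition partial (R : realType) (j : 'I_2) (f : R * R -> R) : R * R -> R :=
  fun x => 'D_(basis2 R j) f x.

Fixpoint Ck (R : realType) (k : nat) (f : R * R -> R) : Prop :=
  match k with
  | 0%N => continuous f
  | k'.+1 => continuous f /\
      forall j : 'I_2,
        (forall x, derivable f x (basis2 R j)) /\ Ck k' (partial j f)
  end.

(* C_c^oo(Omega), extended by 0 to the plane. *)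
Definition test_function (R : realType) (Omega : set (R * R))
    (phi : R * R -> R) : Prop :=
  [/\ forall k, Ck k phi,
      compact (closure [set x | phi x != 0])
    & closure [set x | phi x != 0] `<=` Omega].

Definition in_L (R : realType) (p : \bar R) (Omega : set (R * R))
    (f : R * R -> R) : Prop :=
  (f \_ Omega) \in Lfun (@leb2 R) p.

(* G is an L^2 weak gradient of w on Omega, with G i j = d_j w_i. *)
Definition is_weak_grad (R : realType) (Omega : set (R * R))
    (w : R * R -> 'rV[R]_2) (G : R * R -> 'M[R]_2) : Prop :=
  forall i j : 'I_2,
    in_L 2%:E Omega (fun x => G x i j) /\
    forall phi, test_function Omega phi ->
      \int[@leb2 R]_(x in Omega) (w x ord0 i * partial j phi x) =
      - \int[@leb2 R]_(x in Omega) (G x i j * phi x).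

Definition H1 (R : realType) (Omega : set (R * R)) :
    set (R * R -> 'rV[R]_2) :=
  [set w : R * R -> 'rV[R]_2 | (forall i, in_L 2%:E Omega (fun x => w x ord0 i)) /\
           exists G : R * R -> 'M[R]_2, is_weak_grad Omega w G].

(* The weak gradient is unique up to a null subset of Omega; [get] picks one of
   its representatives (an unspecified value when there is none). *)
Definition wgrad (R : realType) (Omega : set (R * R))
    (w : R * R -> 'rV[R]_2) : R * R -> 'M[R]_2 :=
  get [set G : R * R -> 'M[R]_2 | is_weak_grad Omega w G].

(* A . B = tr (A^T B) and |A|^2 = A . A *)
Definition mdot (R : realType) (m n : nat) (A B : 'M[R]_(m, n)) : R :=
  \tr (A^T *m B).

Definition sqnorm (R : realType) (m n : nat) (A : 'M[R]_(m, n)) : R :=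
  mdot A A.

Definition cof (R : realType) (A : 'M[R]_2) : 'M[R]_2 :=
  \matrix_(i, j) cofactor A i j.

Lemma cofE (R : realType) (A : 'M[R]_2) :
  let i0 := ord0 : 'I_2 in let i1 := ord_max : 'I_2 in
  [/\ cof A i0 i0 = A i1 i1, cof A i0 i1 = - A i1 i0,
      cof A i1 i0 = - A i0 i1 & cof A i1 i1 = A i0 i0].
Proof.
have l0 : lift ord0 (0 : 'I_1) = ord_max :> 'I_2 by apply: val_inj.
have l1 : lift ord_max (0 : 'I_1) = ord0 :> 'I_2 by apply: val_inj.
split; rewrite mxE /cofactor det_mx11 !mxE ?l0 ?l1 /=.
- by rewrite expr0 mul1r.
- by rewrite expr1 mulN1r.
- by rewrite expr1 mulN1r.
- by rewrite -signr_odd /= expr0 mul1r.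
Qed.

Definition H1norm (R : realType) (Omega : set (R * R))
    (w : R * R -> 'rV[R]_2) : R :=
  Num.sqrt (\int[@leb2 R]_(x in Omega)
              (sqnorm (w x) + sqnorm (wgrad Omega w x))).

(* H^1_0(Omega; R^2): the closure of C_c^oo(Omega; R^2) in H^1. *)
Definition H10 (R : realType) (Omega : set (R * R)) :
    set (R * R -> 'rV[R]_2) :=
  [set w : R * R -> 'rV[R]_2 | H1 Omega w /\
     forall eps : R, 0 < eps ->
       exists phi : R * R -> 'rV[R]_2,
         (forall i, test_function Omega (fun x => phi x ord0 i)) /\
         H1norm Omega (w - phi) < eps].

(* H^1_{u0}(Omega; R^2).  As Omega is an arbitrary domain, equality on the
   boundary in the sense of traces means v - u0 \in H^1_0; u0 is given through
   an H^1 function having it as trace. *)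
Definition H1_bc (R : realType) (Omega : set (R * R))
    (u0 : R * R -> 'rV[R]_2) : set (R * R -> 'rV[R]_2) :=
  [set v | H1 Omega v /\ H10 Omega (v - u0)].

Definition admissible (R : realType) (Omega : set (R * R))
    (u0 : R * R -> 'rV[R]_2) (g : R * R -> R) : set (R * R -> 'rV[R]_2) :=
  [set u | H1_bc Omega u0 u /\
     {ae @leb2 R, forall x, Omega x -> \det (wgrad Omega u x) = g x}].

Definition Dirichlet (R : realType) (Omega : set (R * R))
    (u : R * R -> 'rV[R]_2) : R :=
  \int[@leb2 R]_(x in Omega) sqnorm (wgrad Omega u x).

Definition Ffun (R : realType) (Omega : set (R * R)) (f : R * R -> R)
    (u : R * R -> 'rV[R]_2) : R :=
  \int[@leb2 R]_(x in Omega)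
    (sqnorm (wgrad Omega u x) + f x * \det (wgrad Omega u x)).

Definition aform (R : realType) (Omega : set (R * R)) (f : R * R -> R)
    (u phi : R * R -> 'rV[R]_2) : R :=
  \int[@leb2 R]_(x in Omega)
    (2 * mdot (wgrad Omega u x) (wgrad Omega phi x) +
     f x * mdot (cof (wgrad Omega u x)) (wgrad Omega phi x)).

(* Main.v *)
Require Import Defs.
From HB Require Import structures.
From mathcomp Require Import all_boot all_order all_algebra.
From mathcomp Require Import all_classical all_reals all_analysis.
From mathcomp Require Import measurable_realfun ess_sup_inf.
From mathcomp Require Import ring lra.
Set Implicit Arguments.
Unset Strict Implicit.
Unset Printing Implicit Defensive.
Import Order.TTheory GRing.Theory Num.Theory.
Import numFieldNormedType.Exports.
Local Open Scope classical_set_scope.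
Local Open Scope ring_scope.

(** The identity holds pointwise almost everywhere before integration. Write
A, B, D for the weak gradients of u, v, v - u. Expanding the square,
|B|^2 = |A|^2 + 2 A . (B - A) + |B - A|^2, and since det is quadratic with
polarisation cof, cof A . (B - A) + det (B - A) = det B - det A, which vanishes
where both determinants equal g. So if D = B - A the three integrands on the
right add up to |B|^2 (sqnorm_expand), whatever the weight f is; the products
of L^2 functions and the essentially bounded f are integrable, so the integrals
may be added.

The analytic content is that D = B - A almost everywhere, where D is an
arbitrarily chosen weak gradient of v - u. By linearity B - A is also one
(weak_gradB), and weak gradients are unique almost everywhere
(weak_grad_unique). Uniqueness is the fundamental lemma of the calculus of
variations (ae_eq0_test_function): a locally integrable h that is orthogonal to
every test function vanishes almost everywhere. Smooth functions converging
boundedly to the indicator of an open box are built from exp (- 1 / t), so h has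
integral 0 over each box whose closure lies in Omega (integral_box_eq0). Within
one such box, Dynkin's pi-lambda theorem extends this from sub-boxes to all
measurable subsets (ae_eq0_rays), and countably many boxes with rational
corners cover Omega (ae_ratbox). *)

(** * The flat functions P(1/t) exp(-1/t) *)

(** This family, with p arbitrary, is stable under differentiation, which makes
its members smooth without computing higher derivatives. *)
Definition flat (R : realType) (p : {poly R}) (t : R) : R :=
  if 0 < t then p.[t^-1] * expR (- t^-1) else 0.

(** Each power x^i is at most i! exp x, by the exponential series. *)
Lemma horner_le_expR (R : realType) (p : {poly R}) :
  exists C : R, forall x, 0 <= x -> `|p.[x]| <= C * expR x.
Proof.
exists (\sum_(i < size p) `|p`_i| * i`!%:R) => x x0.
rewrite horner_coef mulr_suml (le_trans (ler_norm_sum _ _ _))// ler_sum// => i _.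
rewrite normrM -mulrA ler_wpM2l// ger0_norm ?exprn_ge0//.
have ifact_gt0 : 0 < i`!%:R :> R by rewrite ltr0n fact_gt0.
rewrite mulrC -ler_pdivrMr//.
case: (i : nat) => [|n] /=.
  by rewrite expr0 fact0 divr1 -expR0 ler_expR.
by apply: le_trans (expR_ge1Dxn n x0); rewrite lerDr.
Qed.

(** With x = 1 / t this is the bound of x p(x) by a multiple of exp x; it is what
makes the difference quotients at 0 converge. *)
Lemma flat_le (R : realType) (p : {poly R}) :
  exists C : R, forall t, `|flat p t| <= C * `|t|.
Proof.
have [C Cp] := horner_le_expR ('X * p).
have C0 : 0 <= C.
  by rewrite -(pmulr_lge0 _ (expR_gt0 0)) (le_trans _ (Cp 0 (lexx _))).
exists C => t; rewrite /flat; case: ifPn => [t0|_]; last first.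
  by rewrite normr0 mulr_ge0.
have ti0 : 0 < t^-1 by rewrite invr_gt0.
have := Cp _ (ltW ti0); rewrite hornerM hornerX !normrM.
rewrite (gtr0_norm (expR_gt0 _)) (gtr0_norm ti0) (gtr0_norm t0) => h.
rewrite expRN ler_pdivrMr ?expR_gt0// -mulrA [_ * expR _]mulrC mulrA.
by rewrite -ler_pdivrMr// mulrC.
Qed.

(** Away from 0 the factor 'X^2 comes from the derivative of 1/t. At 0 the
difference quotient of the function given by p is the one given by 'X * p,
which tends to 0. *)
Lemma is_derive_flat (R : realType) (p : {poly R}) (t : R) :
  is_derive t 1 (flat p) (flat ('X^2 * (p - p^`())) t).
Proof.
have [t0|t0|<-] := ltgtP 0 t; last first.
- have E : (fun h : R => h^-1 *: ((flat p \o shift 0) (h *: 1) - flat p 0))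
      @ 0^' --> (0 : R).
    have [C Cp] := flat_le ('X * p).
    have fX : \forall h \near 0^',
        flat ('X * p) h =
        (h^-1 *: ((flat p \o shift 0) (h *: (1 : R)) - flat p 0) : R).
      near=> h => /=; rewrite addr0 /flat ltxx subr0.
      rewrite /GRing.scale/= mulr1.
      by case: ifP; rewrite ?mulr0// hornerM hornerX mulrA.
    apply: cvg_trans (near_eq_cvg fX) _.
    apply/cvgr0Pnorm_le => e e0.
    have C1 : 0 < `|C| + 1 by rewrite ltr_wpDl.
    apply: cvg_within; near=> h.
    (* C may be 0, hence the margin in |C| + 1 before dividing. *)
    apply: le_trans (Cp h) _; apply: le_trans (_ : (`|C| + 1) * `|h| <= _).
      by rewrite ler_wpM2r// (le_trans (ler_norm _))// lerDl.
    rewrite mulrC -ler_pdivlMr//.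
    near: h; apply: (@nbhs0_le R R); exact: divr_gt0.
  split; first by apply/cvg_ex; exists 0.
  by rewrite /flat ltxx; apply: cvg_lim.
- apply: (@near_eq_is_derive R R R (cst 0)).
    near=> x; rewrite /flat ltNge.
    by have -> : x <= 0 by near: x; exact: lt_le_nbhsl.
  by rewrite /flat ltNge (ltW t0)/=; exact: is_derive_cst.
- apply: (@near_eq_is_derive R R R (fun x => p.[x^-1] * expR (- x^-1))).
    near=> x; rewrite /flat.
    by have -> : 0 < x by near: x; exact: lt_nbhsr.
  rewrite /flat t0.
  have tn0 : t != 0 by rewrite gt_eqF.
  have dp : is_derive t^-1 1 (horner p) (p^`().[t^-1]).
    split; first exact: derivable_horner.
    by rewrite -derive1E -derivE.
  have dV : is_derive t (1 : R) (@GRing.inv R) (- t ^- 2 *: 1).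
    exact: (@is_deriveV _ id).
  have dNV : is_derive t (1 : R) (fun x : R => - x^-1) (- (- t ^- 2 *: 1)).
    exact: is_deriveN.
  have de : is_derive t 1 (fun x => expR (- x^-1))
      (expR (- t^-1) * - (- t ^- 2 *: 1)).
    exact: is_derive1_comp.
  have dpV : is_derive t 1 (fun x => p.[x^-1]) (p^`().[t^-1] * (- t ^- 2 *: 1)).
    exact: is_derive1_comp.
  apply: (is_derive_eq (is_deriveM dpV de)).
  rewrite !hornerE /GRing.scale/= !mulr1 -exprVn; ring.
Unshelve. all: by end_near. Qed.

(** * Smooth bump functions on boxes *)

Lemma Ck_continuous (R : realType) k (f : R * R -> R) : Ck k f -> continuous f.
Proof. by case: k => [|k] // []. Qed.

Lemma CkS (R : realType) k (f : R * R -> R) : Ck k.+1 f -> Ck k f.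
Proof.
elim: k f => [|k IH] f [cf df] //=; split=> // j.
by have [? ?] := df j; split=> //; exact: IH.
Qed.

Lemma Ck_add (R : realType) k (f g : R * R -> R) :
  Ck k f -> Ck k g -> Ck k (fun x => f x + g x).
Proof.
elim: k f g => [|k IH] f g /=.
  by move=> cf cg x; apply: cvgD; [exact: cf|exact: cg].
move=> [cf df] [cg dg]; split.
  by move=> x; apply: cvgD; [exact: cf|exact: cg].
move=> j; have [dfj cfj] := df j; have [dgj cgj] := dg j; split.
  by move=> x; exact: derivableD.
rewrite (_ : partial j _ = fun x => partial j f x + partial j g x).
  exact: IH.
by apply/funext => x; rewrite /partial deriveD.
Qed.

Lemma Ck_mul (R : realType) k (f g : R * R -> R) :
  Ck k f -> Ck k g -> Ck k (fun x => f x * g x).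
Proof.
elim: k f g => [|k IH] f g /=.
  by move=> cf cg x; apply: cvgM; [exact: cf|exact: cg].
move=> [cf df] [cg dg]; split.
  by move=> x; apply: cvgM; [exact: cf|exact: cg].
move=> j; have [dfj cfj] := df j; have [dgj cgj] := dg j; split.
  by move=> x; exact: derivableM.
rewrite (_ : partial j _ =
    fun x => f x * partial j g x + g x * partial j f x); last first.
  by apply/funext => x; rewrite /partial deriveM.
by apply: Ck_add; apply: IH => //; apply: CkS.
Qed.

Lemma continuous_flat (R : realType) (p : {poly R}) : continuous (flat p).
Proof.
move=> t; apply/differentiable_continuous/derivable1_diffP.
by have [] := is_derive_flat p t.
Qed.

Definition affine2 (R : realType) (a b d : R) (x : R * R) : R :=
  a * x.1 + b * x.2 + d.

Lemma continuous_affine2 (R : realType) (a b d : R) : continuous (affine2 a b d).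
Proof.
move=> x; apply: cvgD; last exact: cvg_cst.
by apply: cvgD; apply: cvgM; (exact: cvg_cst || exact: cvg_fst || exact: cvg_snd).
Qed.

(** The derivative along v only sees the one-dimensional function along the line
through x, whose slope in the affine coordinate is affine2 a b 0 v. *)
Lemma is_derive_flat_affine2 (R : realType) (p : {poly R}) (a b d : R)
    (x v : R * R) :
  is_derive x v (flat p \o affine2 a b d)
    (flat (affine2 a b 0 v *: ('X^2 * (p - p^`()))) (affine2 a b d x)).
Proof.
set l := affine2 a b d; set lv := affine2 a b 0 v.
have [dp dpE] := is_derive_flat p (l x).
have dlv : derivable (flat p) (l x) lv.
  by apply: diff_derivable; exact/derivable1_diffP.
have dlvE : 'D_lv (flat p) (l x) = lv * flat ('X^2 * (p - p^`())) (l x).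
  rewrite -dpE !deriveE; try exact/derivable1_diffP.
  by rewrite -[in LHS](mulr1 lv) linearZ.
have E : (fun h : R => h^-1 *: (((flat p \o l) \o shift x) (h *: v) - (flat p \o l) x))
    = (fun h => h^-1 *: ((flat p \o shift (l x)) (h *: lv) - flat p (l x))).
  apply/funext => h /=; congr (_ *: (flat p _ - _)).
  by rewrite /l /lv /affine2 /= /GRing.scale /=; ring.
split; first by rewrite /derivable E.
rewrite /derive E -[LHS]/('D_lv (flat p) (l x)) dlvE /flat; case: ifP => _.
  by rewrite hornerZ mulrA.
by rewrite mulr0.
Qed.

(** The order of differentiability can be raised by induction because each partial
derivative is again of the same form, with another polynomial. *)
Lemma Ck_flat_affine2 (R : realType) k (p : {poly R}) (a b d : R) :
  Ck k (flat p \o affine2 a b d).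
Proof.
elim: k p => [|k IH] p /=.
  by move=> x; apply: continuous_comp; [exact: continuous_affine2|exact: continuous_flat].
split.
  by move=> x; apply: continuous_comp; [exact: continuous_affine2|exact: continuous_flat].
move=> j; split.
  by move=> x; have [] := is_derive_flat_affine2 p a b d x (basis2 R j).
rewrite (_ : partial j _ =
    flat (affine2 a b 0 (basis2 R j) *: ('X^2 * (p - p^`()))) \o affine2 a b d).
  exact: IH.
by apply/funext => x; have [_] := is_derive_flat_affine2 p a b d x (basis2 R j).
Qed.

Definition box (R : realType) (a b c d : R) : set (R * R) :=
  `]a, b[%classic `*` `]c, d[%classic.

Definition cbox (R : realType) (a b c d : R) : set (R * R) :=
  `[a, b]%classic `*` `[c, d]%classic.

(** A product of four flat factors, one for each side of the box; as m grows each
factor tends to the indicator of the corresponding half-plane. *)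
Definition bump (R : realType) (a b c d m : R) (x : R * R) : R :=
  flat 1 (affine2 m 0 (- (m * a)) x) * flat 1 (affine2 (- m) 0 (m * b) x) *
  (flat 1 (affine2 0 m (- (m * c)) x) * flat 1 (affine2 0 (- m) (m * d) x)).

Lemma Ck_bump (R : realType) k (a b c d m : R) : Ck k (bump a b c d m).
Proof. by do ![apply: Ck_mul]; exact: Ck_flat_affine2. Qed.

Lemma flat1_neq0 (R : realType) (t : R) : (flat 1 t != 0) = (0 < t).
Proof.
rewrite /flat; case: ifP => _; last by rewrite eqxx.
by rewrite hornerC mul1r expR_eq0.
Qed.

Lemma flat1_itv (R : realType) (t : R) : 0 <= flat 1 t <= 1.
Proof.
rewrite /flat; case: ifP => t0; last by rewrite lexx ler01.
by rewrite hornerC mul1r expR_ge0 expR_le1 oppr_le0 invr_ge0 ltW.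
Qed.

Lemma bump_neq0 (R : realType) (a b c d m : R) (x : R * R) : 0 < m ->
  (bump a b c d m x != 0) <-> box a b c d x.
Proof.
move=> m0; rewrite /bump !mulf_eq0 !negb_or !flat1_neq0 /affine2.
have -> : m * x.1 + 0 * x.2 - m * a = m * (x.1 - a) by ring.
have -> : - m * x.1 + 0 * x.2 + m * b = m * (b - x.1) by ring.
have -> : 0 * x.1 + m * x.2 - m * c = m * (x.2 - c) by ring.
have -> : 0 * x.1 + - m * x.2 + m * d = m * (d - x.2) by ring.
rewrite !pmulr_rgt0// !subr_gt0 /box /= !in_itv /=.
by split=> [/andP[-> ->]|[-> ->]].
Qed.

Lemma bump_itv (R : realType) (a b c d m : R) (x : R * R) :
  0 <= bump a b c d m x <= 1.
Proof.
have F t := andP (flat1_itv (t : R)); rewrite /bump.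
have [[? ?] [? ?]] := (F (affine2 m 0 (- (m * a)) x), F (affine2 (- m) 0 (m * b) x)).
have [[? ?] [? ?]] := (F (affine2 0 m (- (m * c)) x), F (affine2 0 (- m) (m * d) x)).
by rewrite !mulr_ge0//= !mulr_ile1// mulr_ge0.
Qed.

Lemma closed_cbox (R : realType) (a b c d : R) : closed (cbox a b c d).
Proof.
have -> : cbox a b c d = (fst @^-1` `[a, b]%classic) `&` (snd @^-1` `[c, d]%classic).
  by [].
apply: closedI; apply: closed_comp; try exact: itv_closed.
- by move=> x _; exact: cvg_fst.
- by move=> x _; exact: cvg_snd.
Qed.

Lemma box_sub_cbox (R : realType) (a b c d : R) : box a b c d `<=` cbox a b c d.
Proof.
move=> x []; rewrite /= !in_itv/= => /andP[/ltW ? /ltW ?] /andP[/ltW ? /ltW ?].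
by split; rewrite /= in_itv/=; apply/andP.
Qed.

Lemma test_function_bump (R : realType) (Omega : set (R * R)) (a b c d m : R) :
  0 < m -> cbox a b c d `<=` Omega -> test_function Omega (bump a b c d m).
Proof.
move=> m0 sub.
have supp : closure [set x | bump a b c d m x != 0] `<=` cbox a b c d.
  rewrite [X in _ `<=` X](closure_id _).1; last exact: closed_cbox.
  by apply: closureS => x /(bump_neq0 _ _ _ _ _ m0) /box_sub_cbox.
split; [by move=> k; exact: Ck_bump| |exact: subset_trans sub].
apply: (subclosed_compact _ _ supp); first exact: closed_closure.
by apply: compact_setX; exact: segment_compact.
Qed.

Lemma cvg_flat1 (R : realType) (t : R) : 0 < t ->
  flat 1 (n.+1%:R * t) @[n --> \oo] --> (1 : R).
Proof.
move=> t0.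
rewrite (_ : (fun n => _) = fun n => expR (- (harmonic n * t^-1))).
  rewrite -[X in _ --> X]expR0; apply: continuous_cvg; first exact: continuous_expR.
  rewrite -oppr0; apply: cvgN; rewrite -[X in _ --> X](mul0r t^-1).
  by apply: cvgMr_tmp; exact: cvg_harmonic.
by apply/funext => n; rewrite /flat mulr_gt0// hornerC mul1r invfM.
Qed.

Lemma cvg_bump (R : realType) (a b c d : R) (x : R * R) :
  bump a b c d n.+1%:R x @[n --> \oo] --> (\1_(box a b c d) x : R).
Proof.
have [xB|xB] := pselect (box a b c d x); last first.
  rewrite indicE memNset//; apply: cvg_near_cst; apply: nearW => n.
  by apply/eqP/negPn/negP => /(bump_neq0 _ _ _ _ _ (ltr0Sn _ _)).
rewrite indicE mem_set//.
case: xB; rewrite /= !in_itv/= => /andP[ax xb] /andP[cx xd].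
rewrite (_ : (fun n => _) = fun n =>
  flat 1 (n.+1%:R * (x.1 - a)) * flat 1 (n.+1%:R * (b - x.1)) *
  (flat 1 (n.+1%:R * (x.2 - c)) * flat 1 (n.+1%:R * (d - x.2)))).
  rewrite -[X in _ --> X]mulr1; apply: cvgM; rewrite -[X in _ --> X]mulr1;
  by apply: cvgM; apply: cvg_flat1; rewrite subr_gt0.
apply/funext => n; rewrite /bump /affine2.
by congr (flat _ _ * flat _ _ * (flat _ _ * flat _ _)); ring.
Qed.

(** * Boxes and measurability in the plane *)

(** The corners are chosen in the sup-norm ball of radius e around x, which is
itself a box. *)
Lemma open_ratbox (R : realType) (U : set (R * R)) (x : R * R) :
  open U -> U x -> exists q : rat * rat * (rat * rat),
    cbox (ratr q.1.1) (ratr q.1.2) (ratr q.2.1) (ratr q.2.2) `<=` U /\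
    box (ratr q.1.1) (ratr q.1.2) (ratr q.2.1) (ratr q.2.2) x.
Proof.
move=> oU Ux.
have /nbhs_ballP[e /= e0 eU] : nbhs x U by exact: open_nbhs_nbhs.
have lo (t : R) : t - e < t by rewrite ltrBlDr ltrDl.
have hi (t : R) : t < t + e by rewrite ltrDl.
have [a /itvP aE] := rat_in_itvoo (lo x.1).
have [b /itvP bE] := rat_in_itvoo (hi x.1).
have [c /itvP cE] := rat_in_itvoo (lo x.2).
have [d /itvP dE] := rat_in_itvoo (hi x.2).
exists ((a, b), (c, d)); split => /=; last first.
  by split; rewrite /= in_itv/= ?aE ?bE ?cE ?dE.
move=> y [] /=; rewrite !in_itv/= => /andP[ay yb] /andP[cy yd]; apply: eU; split.
- rewrite /ball/= ltr_distlC; apply/andP; split.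
    by apply: lt_le_trans ay; rewrite aE.
  by apply: le_lt_trans yb _; rewrite bE.
- rewrite /ball/= ltr_distlC; apply/andP; split.
    by apply: lt_le_trans cy; rewrite cE.
  by apply: le_lt_trans yd _; rewrite dE.
Qed.

(** Lebesgue measure lives on this copy of R, whose display differs from that of
the measurable structure attached to R. *)
Local Notation plane R := (measurableTypeR R * measurableTypeR R)%type.

Lemma measurable_box (R : realType) (a b c d : R) : measurable (box a b c d).
Proof. exact: measurableX. Qed.

Lemma open_measurable2 (R : realType) (U : set (R * R)) : open U -> measurable U.
Proof.
move=> oU.
pose B (q : rat * rat * (rat * rat)) : set (R * R) :=
  box (ratr q.1.1) (ratr q.1.2) (ratr q.2.1) (ratr q.2.2).
have -> : U = \bigcup_(q in [set q | B q `<=` U]) B q.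
  apply/seteqP; split => [x Ux|x [q /= qU]]; last exact: qU.
  have [q [qU qx]] := open_ratbox oU Ux.
  by exists q => //= y /box_sub_cbox /qU.
rewrite bigcup_mkcond; apply: countable_bigcupT_measurable => // q.
by case: ifP => _ //; exact: measurable_box.
Qed.

Lemma continuous_measurable_fun2 (R : realType) (f : R * R -> R) :
  continuous f -> measurable_fun setT f.
Proof.
move=> /continuousP cf.
apply: (measurability _ (measurable_realfun.RGenOInfty.measurableE R)).
move=> _ [_ [a ->] <-]; rewrite setTI.
by apply: open_measurable2; apply: cf; exact: interval_open.
Qed.

(** Countably many boxes with rational corners suffice, so the exceptional null
sets can be united. *)
Lemma ae_ratbox (R : realType) (mu : {measure set (plane R) -> \bar R})
    (U : set (R * R)) (P : R * R -> Prop) :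
  open U ->
  (forall a b c d, cbox a b c d `<=` U ->
    {ae mu, forall x, box a b c d x -> P x}) ->
  {ae mu, forall x, U x -> P x}.
Proof.
move=> oU aeP.
pose Q n x := forall q : rat * rat * (rat * rat), unpickle n = Some q ->
  cbox (ratr q.1.1) (ratr q.1.2) (ratr q.2.1) (ratr q.2.2) `<=` U ->
  box (ratr q.1.1) (ratr q.1.2) (ratr q.2.1) (ratr q.2.2) x -> P x.
have : {ae mu, forall x, forall n, Q n x}.
  apply/ae_foralln => n; rewrite /Q.
  case: (unpickle n) => [q|]; last by apply: aeW.
  have [qU|qU] := pselect
    (cbox (ratr q.1.1) (ratr q.1.2) (ratr q.2.1) (ratr q.2.2) `<=` U).
    apply: (@filterS _ _ (ae_filter_ringOfSetsType mu)) (aeP _ _ _ _ qU).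
    by move=> x Px q' [<-] _; exact: Px.
  by apply: aeW => x q' [<-] /qU.
apply: (@filterS _ _ (ae_filter_ringOfSetsType mu)) => x Qx Ux.
have [q [qU qx]] := open_ratbox oU Ux.
by apply: (Qx (pickle q) q) => //; rewrite pickleK.
Qed.

Section dynkin.
Context d1 d2 (T : measurableType d1) (U : measurableType d2) (R : realType).
Variables (mu : {measure set T -> \bar R}) (k : T -> \bar R).
Hypothesis ki : mu.-integrable setT k.
Variables (f : T -> U) (mf : measurable_fun setT f) (D : set T) (mD : measurable D).
Variables (G : set (set U)) (GE : @measurable _ U = <<s G >>) (GI : setI_closed G).
Variables (A0 : set U) (GA0 : G A0) (k0 : forall x, ~ A0 (f x) -> k x = 0%E).
Hypothesis kG : forall A, G A -> (\int[mu]_(x in D `&` f @^-1` A) k x = 0)%E.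

(** The sets A over whose preimage k has integral 0 form a Dynkin system. The
set A0 carries k, so that the whole space, which need not be in G, also belongs
to it. *)
Lemma integral_eq0_dynkin A : measurable A ->
  (\int[mu]_(x in D `&` f @^-1` A) k x = 0)%E.
Proof.
have mfA B : measurable B -> measurable (D `&` f @^-1` B).
  by move=> mB; apply: measurableI => //; rewrite -[_ @^-1` _]setTI; exact: mf.
have kS B : measurable B -> mu.-integrable B k.
  by move=> mB; apply: integrableS ki.
(* Off the preimage of A0 the integrand vanishes, so D may be cut down to it. *)
have DT : (\int[mu]_(x in D) k x = 0)%E.
  rewrite -(kG GA0) [RHS]integral_mkcondr; apply: eq_integral => x _.
  rewrite patchE; case: ifPn => // /negP xA; apply: k0 => Ax; apply: xA.
  exact: mem_set.
rewrite GE; apply: (@dynkin_induction _ _ G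
  (fun B => (\int[mu]_(x in D `&` f @^-1` B) k x = 0)%E) GE GI) => //.
- by rewrite preimage_setT setIT.
- move=> S mS S0.
  have : (\int[mu]_(x in (D `&` f @^-1` S) `|` (D `&` f @^-1` (~` S))) k x = 0)%E.
    by rewrite -setIUr -preimage_setU setUv preimage_setT setIT.
  rewrite integral_setU ?S0 ?add0e//.
  + by apply: mfA.
  + by apply: mfA; exact: measurableC.
  + apply: measurable_int; apply: kS; apply: measurableU; apply: mfA => //.
    exact: measurableC.
  + apply/disj_setPS => x [[_ xS] [_]]; exact.
- move=> F mF tF F0.
  rewrite preimage_bigcup setI_bigcupr integral_bigcup.
  + by apply: eseries0 => i _ _; exact: F0.
  + move=> i j _ _ [x [[_ xi] [_ xj]]]; apply: tF => //; by exists (f x).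
  + by move=> i; exact: mfA.
  + by apply: kS; apply: bigcupT_measurable => i; exact: mfA.
Qed.
End dynkin.

(** * The fundamental lemma of the calculus of variations *)

(** Dynkin's theorem is applied three times: in the first coordinate, then in the
second, and finally from measurable rectangles to all measurable sets. The
quadrant carrying k plays the part of the whole plane. *)
Lemma ae_eq0_rays (R : realType) (mu : {measure set (plane R) -> \bar R})
    (k : R * R -> \bar R) (a0 c0 : R) :
  mu.-integrable setT k ->
  (forall x, ~ (`]a0, +oo[%classic `*` `]c0, +oo[%classic) x -> k x = 0%E) ->
  (forall a c, \int[mu]_(x in `]a, +oo[%classic `*` `]c, +oo[%classic) k x = 0)%E ->
  ae_eq mu setT k (cst 0%E).
Proof.
move=> ki k0 kray.
pose G := @measurable_realfun.RGenOInfty.G R.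
have GE : @measurable _ R = <<s G >> := measurable_realfun.RGenOInfty.measurableE R.
have GI : setI_closed G.
  move=> _ _ [a ->] [b ->]; exists (Num.max a b).
  apply/seteqP; split => x; rewrite /= !in_itv/= !andbT gt_max.
    by move=> [-> ->].
  by move=> /andP[-> ->].
have mpre1 (A : set R) : measurable A -> measurable (fst @^-1` A : set (R * R)).
  by move=> mA; rewrite -[X in measurable X]setTI; exact: measurable_fst.
have mpre2 (A : set R) : measurable A -> measurable (snd @^-1` A : set (R * R)).
  by move=> mA; rewrite -[X in measurable X]setTI; exact: measurable_snd.
have step1 A c : measurable A ->
    (\int[mu]_(x in (snd @^-1` `]c, +oo[%classic) `&` fst @^-1` A) k x = 0)%E.
  move=> mA; apply: (@integral_eq0_dynkin _ _ _ _ _ mu k ki fst _ _ _ G GE GI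
    (`]a0, +oo[%classic)) => //.
  - exact: mpre2.
  - by exists a0.
  - by move=> x xa; apply: k0 => -[].
  - by move=> _ [a ->]; rewrite setIC; exact: kray.
have step2 A B : measurable A -> measurable B ->
    (\int[mu]_(x in (fst @^-1` A) `&` snd @^-1` B) k x = 0)%E.
  move=> mA mB; apply: (@integral_eq0_dynkin _ _ _ _ _ mu k ki snd _ _ _ G GE GI
    (`]c0, +oo[%classic)) => //.
  - exact: mpre1.
  - by exists c0.
  - by move=> x xa; apply: k0 => -[].
  - by move=> _ [c ->]; rewrite setIC; exact: step1.
have step3 (S : set (R * R)) : measurable S -> (\int[mu]_(x in S) k x = 0)%E.
  move=> mS; rewrite -[S]setTI -[S]preimage_id.
  apply: (@integral_eq0_dynkin _ _ _ _ _ mu k ki id _ _ _ _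
    (measurable_prod_measurableType R R) _
    (`]a0, +oo[%classic `*` `]c0, +oo[%classic)) => //.
  - move=> _ _ [A mA [B mB <-]] [A' mA' [B' mB' <-]]; rewrite -setXI.
    by exists (A `&` A'); [exact: measurableI|exists (B `&` B') => //; exact: measurableI].
  - by exists (`]a0, +oo[%classic) => //; exists (`]c0, +oo[%classic).
  - move=> _ [A mA [B mB <-]]; rewrite setTI preimage_id; exact: step2.
apply: integral_ae_eq => // E _ mE.
by rewrite step3// integral0.
Qed.

(** Dominated convergence, the bumps being bounded by 1 and tending to the
indicator of the box. *)
Lemma integral_box_eq0 (R : realType) (mu : {measure set (plane R) -> \bar R})
    (Omega : set (R * R)) (h : R * R -> R) (a b c d : R) :
  mu.-integrable (box a b c d) (EFin \o h) ->
  (forall phi, test_function Omega phi ->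
    \int[mu]_(x in Omega) (h x * phi x) = 0) ->
  cbox a b c d `<=` Omega ->
  (\int[mu]_(x in box a b c d) (h x)%:E = 0)%E.
Proof.
move=> hi h0 sub; set B := box a b c d.
have mB : @measurable _ (plane R) B := measurable_box a b c d.
pose phi n := bump a b c d n.+1%:R.
have mh : @measurable_fun _ _ (plane R) R B h.
  by apply/measurable_EFinP; exact: measurable_int hi.
have mphi n : @measurable_fun _ _ (plane R) R B (phi n).
  apply: measurable_funTS; apply: continuous_measurable_fun2.
  exact: (Ck_continuous (Ck_bump 0 _ _ _ _ _)).
have phiB n x : ~ B x -> phi n x = 0.
  move=> xB; apply/eqP/negPn/negP => /(bump_neq0 _ _ _ _ _ (ltr0Sn _ n)); exact: xB.
have dom n x : B x -> (`|(h x * phi n x)%:E| <= `|(h x)%:E|)%E.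
  move=> _; rewrite /= lee_fin normrM ler_piMr//.
  have /andP[p0 p1] := bump_itv a b c d n.+1%:R x.
  by rewrite ger0_norm.
have mhphi n : @measurable_fun _ _ (plane R) _ B (fun x => (h x * phi n x)%:E).
  by apply/measurable_EFinP; exact: measurable_funM.
have I0 n : (\int[mu]_(x in B) (h x * phi n x)%:E = 0)%E.
  have fin : (\int[mu]_(x in B) (h x * phi n x)%:E)%E \is a fin_num.
    apply: integrable_fin_num => //.
    exact: (le_integrable mB (mhphi n) (dom n) hi).
  rewrite -(fineK fin); congr (_%:E).
  rewrite -(h0 (phi n)); last by apply: test_function_bump.
  congr fine; rewrite [LHS]integral_mkcond [RHS]integral_mkcond.
  apply: eq_integral => x _; rewrite !patchE.
  case: ifPn => [/set_mem xB|/negP xB].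
    by rewrite mem_set//; exact/sub/box_sub_cbox.
  by case: ifP => // _; rewrite phiB ?mulr0// => ?; apply: xB; exact: mem_set.
have [||_ _] := @dominated_convergence _ _ _ mu B mB
  (fun n x => (h x * phi n x)%:E) (EFin \o h) (fun x => `|(h x)%:E|%E)
  mhphi (measurable_int _ hi) _ (integrable_abse hi).
- apply: aeW => x xB.
  have -> : (EFin \o h) x = (h x * 1)%:E by rewrite mulr1.
  apply: cvg_EFin; first by apply: nearW.
  apply: cvgM; first exact: cvg_cst.
  have := @cvg_bump _ a b c d x; rewrite indicE mem_set//; exact.
- by apply: aeW => x n xB; exact: dom.
rewrite (_ : [sequence _]_n = cst 0%E); last first.
  by apply/funext => n /=; exact: I0.
move=> F; apply/esym; exact: (cvg_unique _ (cvg_cst _) F).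
Qed.

(** The intersection of a box with a product of rays is again a box, which is why
rays are the generators used. *)
Lemma ae_eq0_test_function (R : realType) (mu : {measure set (plane R) -> \bar R})
    (Omega : set (R * R)) (h : R * R -> R) :
  open Omega ->
  (forall a b c d, cbox a b c d `<=` Omega ->
    mu.-integrable (box a b c d) (EFin \o h)) ->
  (forall phi, test_function Omega phi ->
    \int[mu]_(x in Omega) (h x * phi x) = 0) ->
  {ae mu, forall x, Omega x -> h x = 0}.
Proof.
move=> oO hi h0; apply: ae_ratbox => // a b c d sub.
set B := box a b c d.
have mB : @measurable _ (plane R) B := measurable_box a b c d.
suff : ae_eq mu setT ((EFin \o h) \_ B) (cst 0%E).
  apply: filterS => x /(_ I) + xB; rewrite patchE mem_set//= => /eqP.
  by rewrite eqe => /eqP.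
(* h is cut off outside the box, whose lower-left corner supplies the quadrant. *)
apply: (@ae_eq0_rays _ _ _ a c).
- by rewrite -integrable_mkcond//; exact: hi.
- move=> x xB; rewrite patchE; case: ifPn => // /set_mem [/= xab xcd].
  exfalso; apply: xB; move: xab xcd; rewrite !in_itv/= => /andP[? _] /andP[? _].
  by split; rewrite /= in_itv/= andbT.
- move=> a' c'; rewrite -integral_mkcondr.
  have -> : `]a', +oo[%classic `*` `]c', +oo[%classic `&` B =
      box (Num.max a a') b (Num.max c c') d.
    apply/seteqP; split => x; rewrite /B /box /= !in_itv/= !andbT !gt_max.
      by move=> [[-> ->] [/andP[-> ->] /andP[-> ->]]].
    by move=> [/andP[/andP[-> ->] ->] /andP[/andP[-> ->] ->]].
  have sub' : cbox (Num.max a a') b (Num.max c c') d `<=` Omega.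
    move=> x [] /=; rewrite !in_itv/= !ge_max => /andP[/andP[? _] ?] /andP[/andP[? _] ?].
    by apply: sub; split; rewrite /= in_itv/=; apply/andP.
  by apply: (integral_box_eq0 (Omega := Omega)) => //; exact: hi.
Qed.

(** * Integrability of products *)

Definition mu2 (R : realType) : {measure set (plane R) -> \bar R} :=
  [the {measure set (plane R) -> \bar R} of @leb2 R].

Lemma mu2_cbox_lty (R : realType) (a b c d : R) : (mu2 R (cbox a b c d) < +oo)%E.
Proof.
have -> : (mu2 R (cbox a b c d) =
    lebesgue_measure `[a, b]%classic * lebesgue_measure `[c, d]%classic)%E.
  exact: product_measure1E.
rewrite !lebesgue_measure_itv/=.
by do 2 case: ifP => _; rewrite ?mule0 ?mul0e // -!EFinB -EFinM ltry.
Qed.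

Lemma in_L2_mul (R : realType) (Omega : set (R * R)) (f g : R * R -> R) :
  @measurable _ (plane R) Omega -> in_L 2%:E Omega f -> in_L 2%:E Omega g ->
  (mu2 R).-integrable Omega (EFin \o (fun x => f x * g x)).
Proof.
move=> mO f2 g2; have := Lfun2_mul_Lfun1 f2 g2.
move=> /Lfun1_integrable fg.
apply/(integrable_mkcond _ mO); apply: eq_integrable fg => //= x _.
by rewrite !patchE; case: ifP => // _; rewrite mul0r.
Qed.

Lemma in_L_measurable (R : realType) (p : \bar R) (Omega : set (R * R)) (f : R * R -> R) :
  @measurable _ (plane R) Omega -> in_L p Omega f -> measurable_fun Omega f.
Proof.
move=> mO; rewrite /in_L inE => /andP[+ _]; rewrite inE/= => mf.
by apply/measurable_restrictT.
Qed.

(** On a set of finite measure, |f| <= 1 + f^2 is integrable. *)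
Lemma in_L2_integrable (R : realType) (Omega E : set (R * R)) (f : R * R -> R) :
  @measurable _ (plane R) Omega -> @measurable _ (plane R) E ->
  E `<=` Omega -> (mu2 R E < +oo)%E ->
  in_L 2%:E Omega f -> (mu2 R).-integrable E (EFin \o f).
Proof.
move=> mO mE EO Ey f2.
have mf := in_L_measurable mO f2.
apply: (@le_integrable _ _ _ _ _ mE _ (EFin \o (fun x => 1 + f x * f x))) => //.
- by apply/measurable_EFinP; exact: measurable_funS mf.
- move=> x _; rewrite /= lee_fin [leRHS]ger0_norm; last first.
    by rewrite addr_ge0// -expr2 sqr_ge0.
  (* |f| <= 1 + |f|^2 follows from (|f| - 1)^2 >= 0 and |f|^2 >= 0. *)
  have : 0 <= (`|f x| - 1) ^+ 2 by exact: sqr_ge0.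
  have : 0 <= `|f x| ^+ 2 by exact: sqr_ge0.
  by rewrite -[f x * f x]expr2 -[f x ^+ 2]real_normK ?num_real// => ? ?; nra.
- rewrite (_ : EFin \o _ = ((EFin \o cst 1%R) \+ (EFin \o (fun x => (f x * f x)%R)))%E)//.
  apply: integrableD => //; last first.
    by apply: integrableS (in_L2_mul mO f2 f2).
  by apply: (@measurable_bounded_integrable _ _ _ _ (cst 1)) => //; exact: bounded_cst.
Qed.

(** A compact set lies in a square, hence has finite measure; there f is
integrable and psi is bounded. *)
Lemma in_L2_mul_compact (R : realType) (Omega : set (R * R)) (f psi : R * R -> R)
    (K : set (R * R)) :
  @measurable _ (plane R) Omega -> in_L 2%:E Omega f -> continuous psi ->
  compact K -> (forall x, ~ K x -> psi x = 0) ->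
  (mu2 R).-integrable Omega (EFin \o (fun x => f x * psi x)).
Proof.
move=> mO f2 cpsi cK psi0.
have mf := in_L_measurable mO f2.
have mK : measurable K.
  rewrite -[K]setCK; apply: measurableC; apply: open_measurable2.
  by apply: closed_openC; apply: compact_closed cK; exact: norm_hausdorff.
have Ky : (mu2 R (Omega `&` K) < +oo)%E.
  have [M [_ KM]] := compact_bounded cK.
  have KM1 x : K x -> `|x| <= `|M| + 1.
    by apply: KM; rewrite (le_lt_trans (ler_norm _))// ltrDl.
  set m := `|M| + 1 in KM1.
  apply: (@le_lt_trans _ _ (mu2 R (cbox (- m) m (- m) m))).
    apply: le_measure; rewrite ?inE//; first exact: measurableI.
      exact: measurableX.
    move=> x [_ /KM1]; rewrite prod_normE ge_max => /andP[].
    by rewrite !ler_norml => ? ?; split; rewrite /= in_itv.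
  exact: mu2_cbox_lty.
have fi := in_L2_integrable mO (measurableI _ _ mO mK) (@subIsetl _ _ _) Ky f2.
have mpsi := continuous_measurable_fun2 cpsi.
have bpsi : [bounded psi x | x in Omega `&` K].
  have := compact_bounded (continuous_compact (continuous_subspaceT cpsi) cK).
  move=> [M [Mr MK]]; exists M; split => // N MN x [_ Kx].
  by apply: (MK N MN); exists x.
have : (mu2 R).-integrable (Omega `&` K) ((EFin \o f) \* (EFin \o psi))%E.
  apply: integrableMl => //; first exact: measurableI.
  exact: measurable_funTS.
rewrite integrable_restrict//.
congr (_.-integrable _ _).
apply/funext => x; rewrite patchE; case: ifPn => // /negP xK.
by rewrite /= psi0 ?mulr0// => ?; apply: xK; exact: mem_set.
Qed.

Lemma integrable_mul_ae_bounded d (T : measurableType d) (R : realType)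
    (mu : {measure set T -> \bar R}) (D : set T) (f k : T -> R) (M : R) :
  measurable D -> measurable_fun D f ->
  {ae mu, forall x, D x -> `|f x| <= M} ->
  mu.-integrable D (EFin \o k) ->
  mu.-integrable D (EFin \o (fun x => f x * k x)).
Proof.
move=> mD mf fM /integrableP[/measurable_EFinP mk ki].
apply/integrableP; split; first by apply/measurable_EFinP; exact: measurable_funM.
apply: (@le_lt_trans _ _ (\int[mu]_(x in D) (`|M|%:E * `|(k x)%:E|))%E).
  apply: ae_ge0_le_integral => //.
  - by apply/measurableT_comp => //; apply/measurable_EFinP; exact: measurable_funM.
  - apply: emeasurable_funM => //; apply/measurableT_comp => //.
    exact/measurable_EFinP.
  - apply: filterS fM => x fM Dx; rewrite /= lee_fin normrM ler_wpM2r//.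
    by rewrite (le_trans (fM Dx))// ler_norm.
rewrite ge0_integralZl//; first by apply: lte_mul_pinfty.
by apply/measurableT_comp => //; exact/measurable_EFinP.
Qed.

(** The norm of index +oo is an essential supremum unless the whole plane has
measure 0; in that other case any bound holds almost everywhere. *)
Lemma in_Loo_ae_bounded (R : realType) (Omega : set (R * R)) (f : R * R -> R) :
  in_L +oo%E Omega f ->
  exists M, {ae mu2 R, forall x, Omega x -> `|f x| <= M}.
Proof.
rewrite /in_L inE => /andP[_]; rewrite inE/= /finite_norm unlock.
case: ifPn => [_|mu0] foo.
  have [M fM] := @ess_supr_bounded _ _ _ (mu2 R) (fun x => `|(f \_ Omega) x|) foo.
  exists M; apply: filterS fM => x + Ox.
  by rewrite patchE mem_set.
exists 0; exists setT; split => //.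
by apply/eqP; move: mu0; rewrite lt0e measure_ge0 andbT negbK.
Qed.

(** * Linearity and uniqueness of weak gradients *)

(** Off its closed support, phi vanishes on a neighbourhood. *)
Lemma partial_eq0 (R : realType) j (phi : R * R -> R) (x : R * R) :
  ~ closure [set x | phi x != 0] x -> partial j phi x = 0.
Proof.
move=> xK; rewrite /partial -(@derive_cst _ _ _ (0 : R) x (basis2 R j)).
apply: near_eq_derive.
have : nbhs x (~` closure [set x | phi x != 0]).
  by apply: open_nbhs_nbhs; split => //; exact/closed_openC/closed_closure.
apply: filterS => y yK; apply/eqP/negPn/negP => y0; apply: yK.
exact: subset_closure.
Qed.

(** The two integrands in the definition of a weak gradient are integrable, so that
the integrals there are additive in the field and its gradient; a real-valued
integral of a non-integrable function would carry no information. *)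
Lemma weak_grad_integrable (R : realType) (Omega : set (R * R))
    (f h : R * R -> R) (phi : R * R -> R) j :
  open Omega -> in_L 2%:E Omega f -> in_L 2%:E Omega h ->
  test_function Omega phi ->
  (mu2 R).-integrable Omega (EFin \o (fun x => f x * partial j phi x)) /\
  (mu2 R).-integrable Omega (EFin \o (fun x => h x * phi x)).
Proof.
move=> oO f2 h2 [Cphi cK _]; have mO := open_measurable2 oO.
split; apply: in_L2_mul_compact cK _ => //.
- by have [_ /(_ j)[_]] := Cphi 1%N.
- by move=> x; exact: partial_eq0.
- exact: Ck_continuous (Cphi 0%N).
- by move=> x xK; apply/eqP/negPn/negP => x0; apply: xK; exact: subset_closure.
Qed.

Lemma in_L2B (R : realType) (Omega : set (R * R)) (f h : R * R -> R) :
  in_L 2%:E Omega f -> in_L 2%:E Omega h -> in_L 2%:E Omega (fun x => f x - h x).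
Proof.
move=> f2 h2; rewrite /in_L.
have -> : ((fun x => f x - h x) \_ Omega) = (f \_ Omega) - (h \_ Omega).
  by apply/funext => x; rewrite -[RHS]/((f \_ Omega) x - (h \_ Omega) x) !patchE;
    case: ifP => // _; rewrite subr0.
have [_ lin] := @Lfun_submod_closed _ _ _ (mu2 R) 2%:E (lee1n 2).
by rewrite addrC -scaleN1r; exact: lin.
Qed.

Lemma weak_gradB (R : realType) (Omega : set (R * R)) (u v : R * R -> 'rV[R]_2)
    (G H : R * R -> 'M[R]_2) :
  open Omega ->
  (forall i, in_L 2%:E Omega (fun x => u x ord0 i)) ->
  (forall i, in_L 2%:E Omega (fun x => v x ord0 i)) ->
  is_weak_grad Omega u G -> is_weak_grad Omega v H ->
  is_weak_grad Omega (v - u) (H - G).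
Proof.
move=> oO u2 v2 uG vH i j; have mO := open_measurable2 oO.
have [G2 uGphi] := uG i j; have [H2 vHphi] := vH i j.
split.
  rewrite (_ : (fun x => _) = fun x => H x i j - G x i j); first exact: in_L2B.
  by apply/funext => x; rewrite !mxE.
move=> phi tphi.
have [iu iG] := weak_grad_integrable j oO (u2 i) G2 tphi.
have [iv iH] := weak_grad_integrable j oO (v2 i) H2 tphi.
transitivity (\int[mu2 R]_(x in Omega)
    (v x ord0 i * partial j phi x - u x ord0 i * partial j phi x)).
  by apply: eq_Rintegral => x _; rewrite !mxE mulrBl.
rewrite RintegralB//.
transitivity (- (\int[mu2 R]_(x in Omega)
    (H x i j * phi x - G x i j * phi x))); last first.
  by congr (- _); apply: eq_Rintegral => x _; rewrite !mxE mulrBl.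
rewrite RintegralB// [LHS](congr2 _ (vHphi _ tphi) (congr1 -%R (uGphi _ tphi))).
by rewrite opprB opprK addrC.
Qed.

(** The entries of G - H are locally integrable, being in L^2, and orthogonal to
all test functions. *)
Lemma weak_grad_unique (R : realType) (Omega : set (R * R)) (w : R * R -> 'rV[R]_2)
    (G H : R * R -> 'M[R]_2) :
  open Omega ->
  is_weak_grad Omega w G -> is_weak_grad Omega w H ->
  {ae mu2 R, forall x, Omega x -> G x = H x}.
Proof.
move=> oO wG wH; have mO := open_measurable2 oO.
have ij i j : {ae mu2 R, forall x, Omega x -> G x i j - H x i j = 0}.
  have [G2 Gphi] := wG i j; have [H2 Hphi] := wH i j.
  apply: ae_eq0_test_function => // [a b c d sub|phi tphi].
    apply: in_L2_integrable (in_L2B G2 H2) => //.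
    - exact: measurable_box.
    - exact: subset_trans (@box_sub_cbox _ _ _ _ _) sub.
    - apply: le_lt_trans (mu2_cbox_lty a b c d); apply: le_measure; rewrite ?inE//.
      + exact: measurable_box.
      + exact: measurableX.
      + exact: box_sub_cbox.
  have [_ iG] := weak_grad_integrable j oO G2 G2 tphi.
  have [_ iH] := weak_grad_integrable j oO H2 H2 tphi.
  transitivity (\int[mu2 R]_(x in Omega) (G x i j * phi x - H x i j * phi x)).
    by apply: eq_Rintegral => x _; rewrite mulrBl.
  rewrite RintegralB//; apply/eqP; rewrite subr_eq0 -eqr_opp; apply/eqP.
  exact: etrans (esym (Gphi _ tphi)) (Hphi _ tphi).
have : {ae mu2 R, forall x, forall i j, Omega x -> G x i j - H x i j = 0}.
  have aeF := ae_filter_ringOfSetsType (mu2 R).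
  apply: filter_forall => i; apply: filter_forall => j; exact: ij.
apply: (@filterS _ _ (ae_filter_ringOfSetsType (mu2 R))) => x GH Ox.
by apply/matrixP => i j; apply/eqP; rewrite -subr_eq0 GH.
Qed.

(** * The expansion of the Dirichlet energy *)

Lemma mdot22E (R : realType) (A B : 'M[R]_2) :
  mdot A B = A ord0 ord0 * B ord0 ord0 + A ord0 ord_max * B ord0 ord_max +
    (A ord_max ord0 * B ord_max ord0 + A ord_max ord_max * B ord_max ord_max).
Proof.
have l0 : lift ord0 (0 : 'I_1) = ord_max :> 'I_2 by apply: val_inj.
rewrite /mdot /mxtrace !big_ord_recl big_ord0 !mxE !big_ord_recl !big_ord0 l0 !mxE.
ring.
Qed.

Lemma det22E (R : realType) (A : 'M[R]_2) :
  \det A = A ord0 ord0 * A ord_max ord_max - A ord0 ord_max * A ord_max ord0.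
Proof.
have [E0 E1 _ _] := cofE A.
rewrite (expand_det_row A ord0) !big_ord_recl big_ord0.
have -> : lift ord0 (0 : 'I_1) = ord_max :> 'I_2 by apply: val_inj.
move: E0 E1; rewrite !mxE => -> ->; ring.
Qed.

(** The difference of the two sides is t (det A - det B), because
cof A . (B - A) + det (B - A) = det B - det A. *)
Lemma sqnorm_expand (R : realType) (A B : 'M[R]_2) (t : R) :
  \det A = \det B ->
  sqnorm B = sqnorm A + (2 * mdot A (B - A) + t * mdot (cof A) (B - A)) +
             (sqnorm (B - A) + t * \det (B - A)).
Proof.
have [E1 E2 E3 E4] := cofE A.
move=> AB; apply/eqP; rewrite -subr_eq0; apply/eqP.
transitivity (t * (\det A - \det B)); last by rewrite AB subrr mulr0.
rewrite !det22E /sqnorm !mdot22E E1 E2 E3 E4 !mxE; ring.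
Qed.

Theorem lemma3p2 (R : realType) (Omega : set (R * R))
    (f : R * R -> R) (u0 : R * R -> 'rV[R]_2) (g : R * R -> R)
    (hOmega : domain Omega)
    (hf : in_L +oo%E Omega f)
    (hu0 : H1 Omega u0)
    (u v : R * R -> 'rV[R]_2)
    (hu : admissible Omega u0 g u) (hv : admissible Omega u0 g v) :
  Dirichlet Omega v =
  Dirichlet Omega u + aform Omega f u (v - u) + Ffun Omega f (v - u).
Proof.
have [oO _ _] := hOmega.
have mO : @measurable _ (plane R) Omega := open_measurable2 oO.
have [[[u2 exG] _] detu] := hu; have [[[v2 exH] _] detv] := hv.
have uG : is_weak_grad Omega u (wgrad Omega u) := getPex exG.
have vH : is_weak_grad Omega v (wgrad Omega v) := getPex exH.
have uvGH := weak_gradB oO u2 v2 uG vH.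
have uvD : is_weak_grad Omega (v - u) (wgrad Omega (v - u)).
  by apply: getPex; exists (wgrad Omega v - wgrad Omega u).
(* The chosen weak gradient of v - u agrees a.e. with the difference of the chosen
   weak gradients. *)
have DE := weak_grad_unique oO uvD uvGH.
rewrite /Dirichlet /aform /Ffun.
set A := wgrad Omega u in uG uvGH DE detu *.
set B := wgrad Omega v in vH uvGH DE detv *.
set D := wgrad Omega (v - u) in uvD DE *.
have A2 i j := (uG i j).1; have B2 i j := (vH i j).1; have D2 i j := (uvD i j).1.
have [M fM] := in_Loo_ae_bounded hf.
have mf := in_L_measurable mO hf.
have L2M (h k : R * R -> R) : in_L 2%:E Omega h -> in_L 2%:E Omega k ->
    (mu2 R).-integrable Omega (EFin \o (fun x => h x * k x)).
  by move=> h2 k2; exact: in_L2_mul.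
have iD (h k : R * R -> R) :
    (mu2 R).-integrable Omega (EFin \o h) -> (mu2 R).-integrable Omega (EFin \o k) ->
    (mu2 R).-integrable Omega (EFin \o (fun x => h x + k x)).
  by move=> hi ki; apply: eq_integrable (integrableD mO hi ki).
have iN (h : R * R -> R) : (mu2 R).-integrable Omega (EFin \o h) ->
    (mu2 R).-integrable Omega (EFin \o (fun x => - h x)).
  by move=> hi; apply: eq_integrable (integrableN hi).
have imdot (P Q : R * R -> 'M[R]_2) :
    (forall i j, in_L 2%:E Omega (fun x => P x i j)) ->
    (forall i j, in_L 2%:E Omega (fun x => Q x i j)) ->
    (mu2 R).-integrable Omega (EFin \o (fun x => mdot (P x) (Q x))).
  move=> P2 Q2.
  under eq_fun do rewrite mdot22E.
  by apply: (iD _ _); apply: (iD _ _); apply: (L2M _ _).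
have ifk (k : R * R -> R) : (mu2 R).-integrable Omega (EFin \o k) ->
    (mu2 R).-integrable Omega (EFin \o (fun x => f x * k x)).
  by move=> ki; exact: integrable_mul_ae_bounded fM ki.
have icof : (mu2 R).-integrable Omega
    (EFin \o (fun x => mdot (cof (A x)) (D x))).
  rewrite (_ : (fun x => _) = fun x =>
    A x ord_max ord_max * D x ord0 ord0 + - (A x ord_max ord0 * D x ord0 ord_max) +
    (- (A x ord0 ord_max * D x ord_max ord0) + A x ord0 ord0 * D x ord_max ord_max)).
    by apply: (iD _ _); apply: (iD _ _); rewrite ?iN//; apply: (L2M _ _).
  apply/funext => x; have [E1 E2 E3 E4] := cofE (A x).
  by rewrite mdot22E E1 E2 E3 E4 !mulNr.
have idet : (mu2 R).-integrable Omega (EFin \o (fun x => \det (D x))).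
  under eq_fun do rewrite det22E.
  by apply: (iD _ _); rewrite ?iN//; apply: (L2M _ _).
have iZ (k : R * R -> R) : (mu2 R).-integrable Omega (EFin \o k) ->
    (mu2 R).-integrable Omega (EFin \o (fun x => 2 * k x)).
  by move=> ki; apply: eq_integrable (integrableZl mO 2 ki).
have iA := imdot _ _ A2 A2; have iB := imdot _ _ B2 B2.
have ia : (mu2 R).-integrable Omega (EFin \o (fun x =>
    2 * mdot (A x) (D x) + f x * mdot (cof (A x)) (D x))).
  by apply: (iD _ _); [apply: iZ; exact: imdot|exact: ifk].
have iF : (mu2 R).-integrable Omega (EFin \o (fun x =>
    sqnorm (D x) + f x * \det (D x))).
  by apply: (iD _ _); [exact: imdot|exact: ifk].
(* Each of the three integrands on the right is integrable, so they can be added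
   under one integral and compared pointwise. *)
transitivity (\int[mu2 R]_(x in Omega) (sqnorm (A x) +
    (2 * mdot (A x) (D x) + f x * mdot (cof (A x)) (D x)) +
    (sqnorm (D x) + f x * \det (D x)))); last first.
  by rewrite (RintegralD mO (iD _ _ iA ia) iF) (RintegralD mO iA ia).
congr fine; apply: ae_eq_integral => //.
- exact: measurable_int iB.
- exact: measurable_int (iD _ _ (iD _ _ iA ia) iF).
apply: (@filterS3 _ _ (ae_filter_ringOfSetsType (mu2 R)) _ _ _ _ _ detu detv DE).
move=> x dA dB dD Ox; congr (_%:E); rewrite (dD Ox).
by apply: sqnorm_expand; rewrite dA// dB.
Qed.
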